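(* Let $G=\mathbb{Z}_{r_1}\times\mathbb{Z}_{r_2}\times\cdots\times\mathbb{Z}_{r_n}$, let $V=G_{\varepsilon_1}\oplus G_{\varepsilon_2}\oplus\cdots\oplus G_{\varepsilon_n}$, and let $c=(c_1,c_2,\dots,c_n)\in G$. The exponential generating function for the number of walks of $k$ steps from $0$ to $c$ on the McKay quiver of $(G,V)$ is $$g^c(t)=\sum_{k=0}^\infty (A^k)_{0,c}\,\frac{t^k}{k!}=h_{1+c_1}(t,r_1)\,h_{1+c_2}(t,r_2)\cdots h_{1+c_n}(t,r_n).$$
   Context: $r_1,\dots,r_n$ are positive integers and $\mathbb{Z}_r=\mathbb{Z}/r\mathbb{Z}$. For $a=(a_1,\dots,a_n)\in G$, $G_a$ is the one-dimensional complex $G$-module with character $\chi_a(b)=\omega_1^{a_1b_1}\cdots\omega_n^{a_nb_n}$ for $b=(b_1,\dots,b_n)\in G$, where $\omega_j=e^{2\pi i/r_j}$; these are all the irreducible $G$-modules. $\varepsilon_j\in G$ has $j$th component $1$ and all other components $0$. The McKay quiver of $(G,V)$ is the directed multigraph with node set $G$ whose number of arrows from $a$ to $c$ is the multiplicity of $G_c$ in $G_a\otimes V$; $A$ is its adjacency matrix, and $0=(0,\dots,0)$. For $j\in\mathbb{Z}$ and a positive integer $r$, the generalized hyperbolic function is $h_j(t,r)=r^{-1}\sum_{m=0}^{r-1}\omega^{(1-j)m}e^{\omega^mt}$ with $\omega=e^{2\pi i/r}$; it depends only on $j$ modulo $r$. *)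

(* Defs.v *)
From HB Require Import structures.
From mathcomp Require Import all_boot all_order all_algebra.
From mathcomp Require Import all_fingroup all_solvable all_field all_character.
From mathcomp Require Import complex ring.
From mathcomp Require Import all_classical all_reals all_analysis.

Set Implicit Arguments.
Unset Strict Implicit.
Unset Printing Implicit Defensive.

Import Order.TTheory GRing.Theory Num.Theory.
Import numFieldNormedType.Exports.

Local Open Scope ring_scope.

(* R[i] presented through its numClosedFieldType structure, which is what makes
   the norm topology of numFieldNormedType available on it. *)
Definition Cplx (R : realType) : numClosedFieldType := R[i].

Section ComplexFunctions.
Variable R : realType.
Local Notation C := (Cplx R).

Definition cexp (z : C) : C :=
  (expR (complex.Re z))%:C%C
  * Complex (cos (complex.Im z)) (sin (complex.Im z)).

Definition omega (r : nat) : C := cexp (Complex 0 (2 * pi / r%:R)).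

(* The generalized hyperbolic function h_j(t, r). *)
Definition hyperb (j : int) (t : C) (r : nat) : C :=
  r%:R^-1 *
  \sum_(0 <= m < r) omega r ^ ((1 - j) * m%:Z) * cexp (omega r ^+ m * t).

Definition egf_series (u : nat -> nat) (t : C) : C ^nat :=
  series (fun k => (u k)%:R * (t ^+ k / k`!%:R)).

Lemma cexpD (z w : C) : cexp (z + w) = cexp z * cexp w.
Proof.
case: z w => [x y] [x' y']; rewrite /cexp /= expRD cosD sinD.
apply/eqP; rewrite eq_complex /=.
rewrite !mul0r !addr0 !subr0.
by apply/andP; split; apply/eqP; ring.
Qed.

Lemma omegaX r : (0 < r)%N -> omega r ^+ r = 1.
Proof.
move=> r0.
have cexpX (y : R) k : cexp (Complex 0 y) ^+ k = cexp (Complex 0 (y *+ k)).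
  elim: k => [|k IH].
    rewrite expr0 mulr0n /cexp /= expR0 cos0 sin0.
    by apply/eqP; rewrite eq_complex /= !mul0r !mulr0 subr0 addr0 mulr1 !eqxx.
  rewrite exprS IH -cexpD mulrS; congr cexp.
  by apply/eqP; rewrite eq_complex /= addr0 !eqxx.
rewrite /omega cexpX -[_ *+ r]mulr_natr divfK ?pnatr_eq0 -?lt0n //.
rewrite /cexp /= expR0 mulr_natl cos2pi sin2pi.
by apply/eqP; rewrite eq_complex /= !mul0r !mulr0 subr0 addr0 mulr1 !eqxx.
Qed.

End ComplexFunctions.

Section Multiplicity.
Variables (F : decFieldType) (gT : finGroupType) (G : {group gT}).

(* Multiplicity of an irreducible module S in W: the multiplicity, in the
   socle of W, of the isotypic component of W whose simple summands are
   isomorphic to S (at most one component qualifies, and the value is 0 when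
   there is none).  In characteristic 0 the socle of W is W itself. *)
Definition multiplicity m n
    (S : mx_representation F G m) (W : mx_representation F G n) : nat :=
  (\sum_(U : DecSocleType W | `[< mx_rsim S (socle_repr U) >]) socle_mult U)%N.

End Multiplicity.

Section Walks.
Variables (T : finType) (N : T -> T -> nat).

(* The directed multigraph with N a c arrows from a to c. *)
Definition arrow : finType := {e : T * T & 'I_(N e.1 e.2)}.
Definition arrow_source (e : arrow) : T := (tag e).1.
Definition arrow_target (e : arrow) : T := (tag e).2.

Fixpoint is_walk (a c : T) (w : seq arrow) : bool :=
  if w is e :: w' then (arrow_source e == a) && is_walk (arrow_target e) c w'
  else a == c.

Definition walks (k : nat) (a c : T) : {set k.-tuple arrow} :=
  [set w : k.-tuple arrow | is_walk a c w].

Definition adjacency_mx : 'M[nat]_#|T| :=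
  \matrix_(i, j) N (enum_val i) (enum_val j).

End Walks.

Section Abelian.
Variables (R : realType) (n : nat) (r : 'I_n -> nat).
Local Notation C := (Cplx R).

(* Z/r for r > 0, as {0, ..., r - 1} with addition mod r; MathComp's 'Z_r is
   not used because 'Z_1 has two elements.  As a finGroupType it is written
   multiplicatively, so that 1%g is the zero class. *)
Definition Zr (m : nat) : finGroupType := 'I_m.-1.+1.

Definition prodZ : finGroupType := {dffun forall j : 'I_n, Zr (r j)}.

Definition coordZ (a : prodZ) (j : 'I_n) : nat := (a j : 'I_(r j).-1.+1).

Definition eps (j : 'I_n) : prodZ :=
  [ffun i => inZp (i == j) : 'I_(r i).-1.+1].

Definition chi (a b : prodZ) : C :=
  \prod_(j < n) omega R (r j) ^+ (coordZ a j * coordZ b j).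

Hypothesis r_gt0 : forall j, (0 < r j)%N.

Lemma chi_mx_repr (a : prodZ) :
  mx_repr [set: prodZ]%G (fun b => (chi a b)%:M : 'M[C]_1).
Proof.
split=> [|b b' _ _].
  rewrite /chi big1 // => j _.
  by rewrite /coordZ oneg_ffun muln0.
rewrite -scalar_mxM -big_split; congr (_%:M); apply: eq_bigr => j _ /=.
rewrite -exprD -mulnDr /coordZ mulg_ffun /=.
have w1 : omega R (r j) ^+ (r j).-1.+1 = 1 by rewrite prednK ?omegaX.
by rewrite mulnC [in RHS]mulnC !exprM (expr_mod _ w1).
Qed.

(* The one-dimensional module G_a with character chi a. *)
Definition Gmod (a : prodZ) : mx_representation C [set: prodZ]%G 1 :=
  MxRepresentation (chi_mx_repr a).

Definition Vmod : representation C [set: prodZ]%G :=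
  \big[@dadd_grepr _ _ _/grepr0]_(j < n) Representation (Gmod (eps j)).

Definition mckay (a c : prodZ) : nat :=
  multiplicity (Gmod c) (prod_repr (Gmod a) Vmod).

End Abelian.

(* Main.v *)
(* The characters of G diagonalize the adjacency matrix.  Over a field in which
   |G| is invertible, the multiplicity of a linear S in a module W is
   |G|^-1 sum_x S(x^-1) tr W(x): every simple constituent of W not isomorphic to
   S is annihilated by sum_x S(x^-1) x.  Since the character of V is
   lam x = sum_j omega_j ^ x_j, orthogonality gives
     (A^k)_{a,c} = |G|^-1 sum_x lam x ^ k chi_a x / chi_c x.
   Summing over k turns lam x ^ k into exp (lam x * t), which is a product over
   the coordinates of x, and the sum over x then factors into the h_{1+c_j}.
   That the power series of exp converges to cexp (defined through expR, cos
   and sin) is Taylor's theorem along the segment s |-> s z, 0 <= s <= 1. *)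
Require Import Defs.
From mathcomp Require Import all_boot all_order all_algebra all_fingroup.
From mathcomp Require Import all_solvable all_character complex ring lra.
From mathcomp Require Import all_classical all_reals all_analysis.
Import Order.TTheory GRing.Theory Num.Theory numFieldNormedType.Exports.
Local Open Scope ring_scope.
Local Open Scope classical_set_scope.

(** * Multiplicity of a linear module from traces *)

(** If [S] and [T] are isomorphic, every summand is 1. Otherwise [P] below must vanish: a nonzero
    row of it would span a submodule isomorphic to [S], hence all of the irreducible [T]. *)
Lemma sum_linear_mxtrace_irr (F : fieldType) (gT : finGroupType)
    (G : {group gT}) n (S : mx_representation F G 1)
    (T : mx_representation F G n) :
  mx_irreducible T ->
  \sum_(x in G) S x^-1%g 0 0 * \tr (T x)
    = if `[< mx_rsim S T >] then #|G|%:R else 0.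
Proof.
move=> irrT; case: asboolP => [simST | nsimST].
  have S1 x : S x = (S x 0 0)%:M by exact: mx11_scalar.
  rewrite -sumr_const; apply: eq_bigr => x Gx.
  rewrite -(mxtrace_rsim simST) // (S1 x) mxtrace_scalar mulr1n.
  have : S (x^-1 * x)%g = S x^-1%g *m S x by rewrite repr_mxM ?groupV.
  rewrite mulVg repr_mx1 (S1 x^-1%g) (S1 x) -scalar_mxM.
  by move/matrixP/(_ 0 0); rewrite !mxE !mulr1n => <-.
(* [P] is, up to a scalar, the projection onto the [S]-isotypic part of [T]. *)
pose P := \sum_(x in G) S x^-1%g 0 0 *: T x.
have -> : \sum_(x in G) S x^-1%g 0 0 * \tr (T x) = \tr P.
  by rewrite raddf_sum; apply: eq_bigr => x _; rewrite /= mxtraceZ.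
(* Reindex the sum by [x * y]. *)
have PT y : y \in G -> P *m T y = S y 0 0 *: P.
  move=> Gy; rewrite /P mulmx_suml scaler_sumr.
  rewrite [RHS](reindex_inj (mulIg y)) /=.
  apply: eq_big => [x | x Gx]; first by rewrite groupMr.
  rewrite -scalemxAl -repr_mxM // scalerA; congr (_ *: _).
  rewrite invMg repr_mxM ?groupV // [in RHS]mxE big_ord1 mulrA.
  have : S (y * y^-1)%g = S y *m S y^-1%g by rewrite repr_mxM ?groupV.
  rewrite mulgV repr_mx1; move/matrixP/(_ 0 0).
  by rewrite !mxE big_ord1 mulr1n => <-; rewrite mul1r.
case: (eqVneq P 0) => [-> | nzP]; first by rewrite mxtrace0.
case: nsimST.
have [i nzv] : exists i, row i P != 0.
  apply/existsP; apply: contraR nzP; rewrite negb_exists => /forallP rP.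
  apply/eqP/row_matrixP => i; rewrite row0; apply/eqP.
  by rewrite -[_ == _]negbK.
set v := row i P in nzv.
have vT y : y \in G -> v *m T y = S y 0 0 *: v.
  by move=> Gy; rewrite /v -row_mul PT // linearZ.
have /mx_irrP[n_gt0 full] := irrT.
have rv : \rank v = 1%N by rewrite rank_rV nzv.
have fullv : row_full (<<v>>%MS).
  apply: full; last by rewrite -mxrank_eq0 mxrank_gen rv.
  rewrite (eqmx_module _ (genmxE v)).
  by apply/mxmoduleP => y Gy; rewrite vT // scalemx_sub.
have n1 : 1%N = n.
  by move: fullv; rewrite /row_full mxrank_gen rv => /eqP.
(* The row [v], now a 1 x 1 matrix of rank 1, intertwines [S] and [T]. *)
apply: (MxReprSim (B := v)) => // [|y Gy]; first by rewrite /row_free rv.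
by rewrite vT // (mx11_scalar (S y)) mul_scalar_mx mxE eqxx mulr1n.
Qed.

(** By Maschke's theorem the socle is all of [W], so the trace of [W] is the sum of the traces of
    its simple constituents weighted by [socle_mult]; [sum_linear_mxtrace_irr] keeps only those
    isomorphic to [S]. *)
Lemma multiplicity_linear (F : decFieldType) (gT : finGroupType)
    (G : {group gT}) n (S : mx_representation F G 1)
    (W : mx_representation F G n) :
  pgroup [pchar F]^' G ->
  \sum_(x in G) S x^-1%g 0 0 * \tr (W x) = (multiplicity S W * #|G|)%:R.
Proof.
move=> charG.
have soc1 : (Socle (DecSocleType W) :=: 1%:M)%MS.
  by rewrite reducible_Socle1 //; exact: mx_Maschke_pchar.
transitivity (\sum_(U : DecSocleType W) \sum_(x in G)
    S x^-1%g 0 0 * \tr (socle_repr U x) *+ socle_mult U).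
  rewrite exchange_big; apply: eq_bigr => x Gx /=.
  rewrite -(mxtrace_submod1 (Socle_module (DecSocleType W)) soc1) //.
  rewrite mxtrace_Socle // mulr_sumr; apply: eq_bigr => U _.
  by rewrite mulrnAr.
rewrite /multiplicity big_distrl /= natr_sum [RHS]big_mkcond.
apply: eq_bigr => U _; rewrite sumrMnl sum_linear_mxtrace_irr.
  by case: ifP => _; rewrite ?mul0rn // natrM mulr_natl.
exact: socle_irr.
Qed.

(** * The complex exponential as the sum of its power series *)

(** By the mean value theorem [g + f] and [g - f], which vanish at 0 and have nonnegative
    derivatives on [[0, 1]], are nonnegative there. This integrates a bound on one Taylor remainder
    into a bound on the next. *)
Lemma norm_le_of_derive (R : realType) (f df g dg : R -> R) :
  (forall x : R, is_derive x 1 f (df x)) ->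
  (forall x : R, is_derive x 1 g (dg x)) ->
  f 0 = 0 -> g 0 = 0 ->
  (forall x, 0 <= x <= 1 -> `|df x| <= dg x) ->
  forall x, 0 <= x <= 1 -> `|f x| <= g x.
Proof.
move=> fD gD f0 g0 dle x /andP[x0 x1].
have main (h dh : R -> R) : (forall y : R, is_derive y 1 h (dh y)) -> h 0 = 0 ->
    (forall y, 0 <= y <= 1 -> 0 <= dh y) -> 0 <= h x.
  move=> hD h0 dh0.
  have hc : {within `[0, x], continuous h}.
    by apply: derivable_within_continuous => y _; exact: ex_derive.
  have [c] := MVT_segment x0 (fun y _ => hD y) hc.
  rewrite h0 !subr0 in_itv /= => /andP[c0 cx] ->.
  by rewrite mulr_ge0 // dh0 // c0 (le_trans cx).
rewrite ler_norml; apply/andP; split.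
- rewrite -subr_ge0 opprK; apply: (main (f + g) (fun y => df y + dg y)).
  + by change (f 0 + g 0 = 0); rewrite f0 g0 addr0.
  + move=> y /dle; rewrite ler_norml => /andP[+ _].
    by rewrite -subr_ge0 opprK.
- rewrite -subr_ge0; apply: (main (g - f) (fun y => dg y - df y)).
  + by change (g 0 - f 0 = 0); rewrite f0 g0 subr0.
  + by move=> y /dle; rewrite ler_norml => /andP[_]; rewrite subr_ge0.
Qed.

Section ComplexExponentialSeries.
Variables (R : realType) (x y : R).

(* Real and imaginary parts of [z ^ k], [\sum_(k < N) (s z) ^ k / k!] and
   [exp (s z)], where [z = x + i y] and [s] is real. *)
Let zk (k : nat) : R * R :=
  iter k (fun p => (x * p.1 - y * p.2, x * p.2 + y * p.1)) (1, 0).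
Let P (N : nat) (s : R) := \sum_(0 <= k < N) (zk k).1 * (s ^+ k / k`!%:R).
Let Q (N : nat) (s : R) := \sum_(0 <= k < N) (zk k).2 * (s ^+ k / k`!%:R).
Let re (s : R) := expR (s * x) * cos (s * y).
Let im (s : R) := expR (s * x) * sin (s * y).

Let is_derive_term (a s : R) k :
  is_derive s 1 (fun s => a * (s ^+ k.+1 / k.+1`!%:R)) (a * (s ^+ k / k`!%:R)).
Proof.
have -> : (fun s => a * (s ^+ k.+1 / k.+1`!%:R))
    = (a / k.+1`!%:R) *: (@id R) ^+ k.+1.
  apply/funext => u; rewrite /GRing.scale /= exprfctE.
  by rewrite mulrCA mulrC.
apply: is_derive_eq.
have k0 : k`!%:R != 0 :> R by rewrite pnatr_eq0 -lt0n fact_gt0.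
have k1 : k.+1%:R != 0 :> R by rewrite pnatr_eq0.
by rewrite /GRing.scale /= factS natrM; field; rewrite k0 addrC natr1 k1.
Qed.

(** Differentiating the partial sum of [exp (s z)] with [N + 1] terms gives [z] times the one with
    [N] terms; this is the real part, and [is_derive_Q] is the imaginary part. *)
Let is_derive_P N (s : R) : is_derive s 1 (P N.+1) (x * P N s - y * Q N s).
Proof.
elim: N => [|N IH].
  rewrite /P /Q !big_geq // !mulr0 subr0.
  have -> : (fun s => \sum_(0 <= k < 1) (zk k).1 * (s ^+ k / k`!%:R)) = cst 1.
    by apply/funext => u; rewrite big_nat1 /= expr0 fact0 divr1 mulr1.
  exact: is_derive_cst.
have -> : P N.+2 = P N.+1 + (fun s => (zk N.+1).1 * (s ^+ N.+1 / N.+1`!%:R)).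
  by apply/funext => u; rewrite fctE /P big_nat_recr.
have := is_deriveD IH (is_derive_term (zk N.+1).1 s N).
move/is_derive_eq; apply.
by rewrite /P /Q !big_nat_recr //=; ring.
Qed.

Let is_derive_Q N (s : R) : is_derive s 1 (Q N.+1) (x * Q N s + y * P N s).
Proof.
elim: N => [|N IH].
  rewrite /P /Q !big_geq // !mulr0 addr0.
  have -> : (fun s => \sum_(0 <= k < 1) (zk k).2 * (s ^+ k / k`!%:R)) = cst 0.
    by apply/funext => u; rewrite big_nat1 /= mul0r.
  exact: is_derive_cst.
have -> : Q N.+2 = Q N.+1 + (fun s => (zk N.+1).2 * (s ^+ N.+1 / N.+1`!%:R)).
  by apply/funext => u; rewrite fctE /Q big_nat_recr.
have := is_deriveD IH (is_derive_term (zk N.+1).2 s N).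
move/is_derive_eq; apply.
by rewrite /P /Q !big_nat_recr //=; ring.
Qed.

Let is_mulr (a s : R) : is_derive s 1 (fun u => u * a) a.
Proof. by apply: is_derive_eq; rewrite scaler0 add0r /GRing.scale /= mulr1. Qed.

Let is_derive_re (s : R) : is_derive s 1 re (x * re s - y * im s).
Proof.
have Dx := @is_derive1_comp _ expR ( *%R^~ x) s _ _
  (is_derive_expR (s * x)) (is_mulr x s).
have Dy := @is_derive1_comp _ cos ( *%R^~ y) s _ _
  (is_derive_cos (s * y)) (is_mulr y s).
apply: is_derive_eq (is_deriveM Dx Dy) _.
by rewrite /re /im /GRing.scale /=; ring.
Qed.

Let is_derive_im (s : R) : is_derive s 1 im (x * im s + y * re s).
Proof.
have Dx := @is_derive1_comp _ expR ( *%R^~ x) s _ _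
  (is_derive_expR (s * x)) (is_mulr x s).
have Dy := @is_derive1_comp _ sin ( *%R^~ y) s _ _
  (is_derive_sin (s * y)) (is_mulr y s).
apply: is_derive_eq (is_deriveM Dx Dy) _.
by rewrite /re /im /GRing.scale /=; ring.
Qed.

Let K := `|x| + `|y|.

(* The remainder of order [N + 1] has derivative [z] times that of order [N]. *)
Let exp_remainder N (s : R) : 0 <= s <= 1 ->
  `|re s - P N s| <= expR `|x| * K ^+ N * (s ^+ N / N`!%:R) /\
  `|im s - Q N s| <= expR `|x| * K ^+ N * (s ^+ N / N`!%:R).
Proof.
elim: N s => [|N IH] s s01.
  (* For [N = 0] the sums are empty, and [re s], [im s] themselves are bounded by [expR |x|]. *)
  rewrite /P /Q !big_geq // !subr0 !expr0 fact0 divr1 !mulr1 /re /im.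
  have /andP[s0 s1] := s01.
  have le : `|expR (s * x)| <= expR `|x|.
    rewrite ger0_norm ?expR_ge0 // ler_expR (le_trans (ler_norm _)) //.
    by rewrite normrM ger0_norm // ler_piMl.
  by split; rewrite normrM -[leRHS]mulr1 ler_pM // ?cos_max ?sin_max.
(* Each component of a product by [z] enlarges a common bound [w] of both components by a factor of
   at most [K]; this produces the powers of [K]. *)
have le a b (u v w : R) : `|u| <= w -> `|v| <= w -> `|a| + `|b| = K ->
    `|a * u + b * v| <= K * w.
  move=> uw vw <-; rewrite (le_trans (ler_normD _ _)) // mulrDl !normrM.
  by rewrite lerD // ler_wpM2l.
have bound0 : expR `|x| * K ^+ N.+1 * (0 ^+ N.+1 / N.+1`!%:R) = 0 :> R.
  by rewrite expr0n mul0r mulr0.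
have P0 : P N.+1 0 = 1.
  rewrite /P big_nat_recl // big1 ?addr0 ?expr0 ?fact0 ?divr1 ?mulr1 //.
  by move=> k _; rewrite exprS !mul0r mulr0.
have Q0 : Q N.+1 0 = 0.
  rewrite /Q big1 // => -[|k] _; first by rewrite mul0r.
  by rewrite exprS !mul0r mulr0.
split.
- refine (@norm_le_of_derive R (re - P N.+1) _ _ _
    (fun u => is_deriveB (is_derive_re u) (is_derive_P N u))
    (fun u => is_derive_term (expR `|x| * K ^+ N.+1) u N) _ bound0 _ s s01).
    change (re 0 - P N.+1 0 = 0).
    by rewrite P0 /re !mul0r expR0 cos0 mulr1 subrr.
  move=> u /IH[ru iu].
  have -> : x * re u - y * im u - (x * P N u - y * Q N u)
    = x * (re u - P N u) + (- y) * (im u - Q N u) by ring.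
  rewrite exprS [leRHS](_ : _ = K * (expR `|x| * K ^+ N * (u ^+ N / N`!%:R))).
    by apply: le; rewrite ?normrN.
  by ring.
- refine (@norm_le_of_derive R (im - Q N.+1) _ _ _
    (fun u => is_deriveB (is_derive_im u) (is_derive_Q N u))
    (fun u => is_derive_term (expR `|x| * K ^+ N.+1) u N) _ bound0 _ s s01).
    by change (im 0 - Q N.+1 0 = 0); rewrite Q0 /im !mul0r sin0 mulr0 subrr.
  move=> u /IH[ru iu].
  have -> : x * im u + y * re u - (x * Q N u + y * P N u)
    = x * (im u - Q N u) + y * (re u - P N u) by ring.
  rewrite exprS [leRHS](_ : _ = K * (expR `|x| * K ^+ N * (u ^+ N / N`!%:R))).
    by apply: le.
  by ring.
Qed.

Let series_exp_Complex N :
  series (fun k => Complex x y ^+ k / k`!%:R) N = Complex (P N 1) (Q N 1).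
Proof.
have zE k : Complex x y ^+ k = Complex (zk k).1 (zk k).2 :> R[i].
  elim: k => [|k IH]; first by rewrite expr0.
  by rewrite exprS IH /=; apply/eqP; rewrite eq_complex /= !eqxx.
have natE k : (k%:R : R[i]) = (k%:R)%:C%C by rewrite rmorph_nat.
rewrite /series /= /P /Q; elim: N => [|N IH]; first by rewrite !big_geq.
rewrite !big_nat_recr //= IH zE natE -fmorphV.
by apply/eqP; rewrite eq_complex /= !expr1n !mul1r !mulr0 subr0 add0r !eqxx.
Qed.

(** At [s = 1] both components of the remainder are at most [expR |x| * K ^ N / N!], which tends to
    0. *)
Lemma series_cvg_cexp_Complex :
  series (fun k => (Complex x y : Cplx R) ^+ k / k`!%:R) @ \oo
    --> (cexp (Complex x y) : Cplx R).
Proof.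
have normC (a b : R) : (`|Complex a b| <= (`|a| + `|b|)%:C%C :> R[i]).
  have -> : Complex a b = a%:C%C + Complex 0 b.
    by apply/eqP; rewrite eq_complex /= addr0 add0r !eqxx.
  rewrite rmorphD (le_trans (ler_normD _ _)) // !normc_def /= expr0n /=.
  by rewrite addr0 add0r !sqrtr_sqr.
apply/cvgrPdist_lt => /= e e0.
(* In the partial order of [R[i]], a positive element is real. *)
have [d d0 ->] : exists2 d : R, 0 < d & e = d%:C%C.
  move: e0; rewrite ltcE /= => /andP[/eqP eI eR].
  by exists (complex.Re e) => //; apply/eqP; rewrite eq_complex /= eI !eqxx.
(* The factor 2 adds up the real and the imaginary remainder, as in [normC]. *)
have : (expR `|x| * exp_coeff K N) *+ 2 @[N --> \oo] --> (expR `|x| * 0) *+ 2.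
  by apply: cvgMn; apply: cvgMr; exact: cvg_exp_coeff.
rewrite mulr0 mul0rn => /cvgrPdist_lt/(_ _ d0); apply: filterS => N.
rewrite sub0r normrN => lt_d.
have [] := @exp_remainder N 1; first by rewrite ler01 lexx.
have -> : expR `|x| * K ^+ N * (1 ^+ N / N`!%:R) = expR `|x| * exp_coeff K N.
  by rewrite expr1n /exp_coeff /= -mulrA mul1r.
move=> re_le im_le; rewrite series_exp_Complex /cexp.
have -> : (expR (complex.Re (Complex x y)))%:C%C
     * Complex (cos (complex.Im (Complex x y))) (sin (complex.Im (Complex x y)))
     - Complex (P N 1) (Q N 1) = Complex (re 1 - P N 1) (im 1 - Q N 1).
  apply/eqP; rewrite eq_complex /re /im /= !mul1r !mul0r subr0 addr0.
  by rewrite !eqxx.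
apply: le_lt_trans (normC _ _) _; rewrite ltcR; apply: le_lt_trans lt_d.
by rewrite (le_trans _ (ler_norm _)) // mulr2n lerD.
Qed.
End ComplexExponentialSeries.

Lemma series_cvg_cexp (R : realType) (z : Cplx R) :
  series (fun k => z ^+ k / k`!%:R) @ \oo --> cexp z.
Proof. by case: z => x y; exact: series_cvg_cexp_Complex. Qed.

(** * Distributivity over dependent functions, and walks as matrix powers *)

(** The types [T i] are merged into their disjoint union, where distributivity over a single index
    type applies. This is what factors sums over [prodZ] into sums over the coordinates. *)
Lemma bigA_distr_dffun (R : Type) (zero one : R) (times : Monoid.mul_law zero)
    (plus : Monoid.add_law zero times) (I : finType) (T : I -> finType)
    (F : forall i, T i -> R) :
  \big[times/one]_i \big[plus/zero]_(x : T i) F i x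
    = \big[plus/zero]_(f : {dffun forall i, T i}) \big[times/one]_i F i (f i).
Proof.
rewrite (reindex (@dffun_of_fprod I T)) /=; last first.
  exact/onW_bij/dffun_of_fprod_bij.
transitivity (\big[plus/zero]_(t : fprod T)
    \big[times/one]_(i in I) [ffun x => F i x] (t i)); last first.
  apply: eq_bigr => t _; apply: eq_bigr => i _.
  by rewrite !ffunE.
rewrite big_fprod.
transitivity (\big[times/one]_i \big[plus/zero]_(j | tagged_with T i j)
    untag zero [ffun x => F i x] j).
  apply: eq_bigr => i _; rewrite -(big_tag (fun i => [ffun x => F i x])).
  by apply: eq_bigr => x _; rewrite ffunE.
by rewrite bigA_distr_big_dep.
Qed.

(** Induction on [k]: splitting off the first arrow of a walk mirrors [A ^ (k + 1) = A * A ^ k]. *)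
Lemma card_walks (T : finType) (N : T -> T -> nat) k (a c : T) :
  #|walks N k a c| = (adjacency_mx N ^+ k) (enum_rank a) (enum_rank c).
Proof.
elim: k a => [|k IH] a.
  rewrite expr0 mxE (inj_eq enum_rank_inj).
  case: eqP => [-> | /eqP neq].
    rewrite (@eq_card _ _ predT) ?card_tuple // => w.
    by rewrite inE tuple0 /= eqxx.
  by rewrite eq_card0 // => w; rewrite inE tuple0 /= (negbTE neq).
rewrite exprS mxE (reindex enum_rank) /=; last exact/onW_bij/enum_rank_bij.
transitivity (\sum_(e : arrow N | arrow_source e == a)
    #|walks N k (arrow_target e) c|)%N.
  rewrite -sum1_card.
  rewrite (reindex (fun p : arrow N * k.-tuple (arrow N) =>
    [tuple of p.1 :: p.2])) /=; last first.
    exists (fun w => (thead w, [tuple of behead w])) => [[e w] _|w _] /=.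
      by congr (_, _); apply: val_inj.
    by case/tupleP: w => e w; apply: val_inj.
  rewrite (eq_bigl (fun p : arrow N * k.-tuple (arrow N) =>
      (arrow_source p.1 == a) && (p.2 \in walks N k (arrow_target p.1) c)));
    last first.
    by move=> [e w]; rewrite !inE.
  rewrite -(pair_big_dep (fun e : arrow N => arrow_source e == a)
    (fun e w => w \in walks N k (arrow_target e) c) (fun _ _ => 1%N)).
  by apply: eq_bigr => e _; rewrite sum1_card.
(* Parallel arrows are grouped by their endpoints. *)
transitivity (\sum_(e : T * T | e.1 == a) N e.1 e.2 * #|walks N k e.2 c|)%N.
  rewrite /arrow_source /arrow_target /arrow.
  transitivity (\sum_(e : T * T | e.1 == a) \sum_(i < N e.1 e.2)
      #|walks N k e.2 c|)%N.
    rewrite (sig_big_dep (fun e : T * T => e.1 == a) (fun _ _ => true)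
      (fun e _ => #|walks N k e.2 c|)) /=.
    by apply: eq_bigl => p; rewrite andbT.
  by apply: eq_bigr => e _; rewrite sum_nat_const card_ord.
rewrite (eq_bigl (fun e : T * T => (e.1 == a) && true)); last first.
  by move=> e; rewrite andbT.
rewrite -(pair_big_dep (fun x => x == a) (fun _ _ => true)
   (fun x y => N x y * #|walks N k y c|)%N) big_pred1_eq.
by apply: eq_bigr => b _; rewrite IH mxE !enum_rankK.
Qed.

(** * Roots of unity and characters of the product of cyclic groups *)

Section CyclicProduct.
Variable R : realType.
Local Notation C := (Cplx R).

Lemma cexp0 : cexp (0 : C) = 1.
Proof.
rewrite /cexp /= expR0 cos0 sin0.
by apply/eqP; rewrite eq_complex /= !mul0r !mulr0 subr0 addr0 mulr1 !eqxx.
Qed.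

Lemma cexp_sum I (s : seq I) (F : I -> C) :
  cexp (\sum_(i <- s) F i) = \prod_(i <- s) cexp (F i).
Proof. exact: (big_morph _ (@cexpD R) cexp0). Qed.

Lemma Re_omegaX r k :
  complex.Re (omega R r ^+ k) = cos (2 * pi / r%:R * k%:R) :> R.
Proof.
have -> : omega R r ^+ k = cexp (Complex 0 (2 * pi / r%:R * k%:R)).
  elim: k => [|k IH]; first by rewrite expr0 mulr0 -cexp0.
  rewrite exprSr IH /omega -cexpD; congr cexp.
  apply/eqP; rewrite eq_complex /= addr0.
  by rewrite -(natr1 k) (mulrDr _ k%:R) mulr1 !eqxx.
by rewrite /cexp /= expR0 mul1r mul0r subr0.
Qed.

(** Let [m] be the exact order of [omega R r], a divisor of [r]. If [m < r], the real part of its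
    [m]th power is less than 1, so that power is not 1. *)
Lemma omega_prim r : (0 < r)%N -> r.-primitive_root (omega R r).
Proof.
move=> r0; have [m prim_m m_dvd_r] := prim_order_exists r0 (omegaX R r0).
have := dvdn_leq r0 m_dvd_r; rewrite leq_eqVlt => /predU1P[mr|m_lt_r].
  by rewrite -{1}mr.
have m0 := prim_order_gt0 prim_m.
(* [cos (2 a) = 1 - 2 (sin a)^2 < 1] for [a = pi m / r] in [(0, pi)] *)
pose a : R := pi * (m%:R / r%:R).
have r0' : 0 < r%:R :> R by rewrite ltr0n.
have sina : 0 < sin a.
  apply: sin_gt0_pi; rewrite mulr_gt0 ?pi_gt0 ?divr_gt0 ?ltr0n //=.
  by rewrite /a gtr_pMr ?pi_gt0 // ltr_pdivrMr // mul1r ltr_nat.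
have := Re_omegaX r m; rewrite (prim_expr_order prim_m) /=.
have -> : 2 * pi / r%:R * m%:R = a *+ 2 by rewrite /a -mulr_natl; ring.
rewrite cos_mulr2n cos2sin2 => cosE.
have : 0 < sin a ^+ 2 by rewrite exprn_gt0.
by move: cosE; move: (sin a ^+ 2) => s; lra.
Qed.

Lemma omega_neq0 r : (0 < r)%N -> omega R r != 0.
Proof.
move=> r0; apply: contra_eqN (omegaX R r0) => /eqP ->.
by rewrite expr0n gtn_eqF // eq_sym oner_eq0.
Qed.

Variables (n : nat) (r : 'I_n -> nat).
Hypothesis r_gt0 : forall j, (0 < r j)%N.
Local Notation G := (prodZ r).

Lemma coordZ_lt (a : G) j : (coordZ a j < r j)%N.
Proof. by rewrite /coordZ (leq_trans (ltn_ord _)) // prednK. Qed.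

Lemma chiC (a b : G) : chi R a b = chi R b a.
Proof. by apply: eq_bigr => j _; rewrite mulnC. Qed.

Lemma chi_neq0 (a b : G) : chi R a b != 0.
Proof. by apply/prodf_neq0 => j _; rewrite expf_neq0 // omega_neq0. Qed.

Lemma chi1 (a : G) : chi R a 1%g = 1.
Proof.
by rewrite /chi big1 // => j _; rewrite /coordZ oneg_ffun muln0.
Qed.

Lemma chiV (a b : G) : chi R a b^-1%g = (chi R a b)^-1.
Proof.
apply: (mulIf (chi_neq0 a b)); rewrite mulVf ?chi_neq0 //.
have [_ /(_ b^-1%g b)] := chi_mx_repr R r_gt0 a.
rewrite mulVg chi1 -scalar_mxM => /(_ (finset.in_setT _) (finset.in_setT _)).
by move/matrixP/(_ 0 0); rewrite !mxE !mulr1n.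
Qed.

(** For distinct [x] and [y], the sum factors over the coordinates, and the geometric sum at a
    coordinate where they differ is 0. *)
Lemma chi_orthogonality (x y : G) :
  \sum_b chi R b x / chi R b y = if x == y then #|G|%:R else 0.
Proof.
case: eqP => [<- | /eqP neq_xy].
  rewrite -sumr_const; apply: eq_bigr => b _.
  by rewrite divff ?chi_neq0.
have [j neq_j] : exists j, coordZ x j != coordZ y j.
  apply/existsP; apply: contraR neq_xy; rewrite negb_exists => /forallP eq_xy.
  apply/eqP/ffunP => j; apply: val_inj; apply/eqP.
  by have := eq_xy j; rewrite negbK.
pose z j := omega R (r j) ^+ coordZ x j / omega R (r j) ^+ coordZ y j.
transitivity (\sum_(b : G) \prod_j z j ^+ (b j : 'I_(r j).-1.+1)).
  apply: eq_bigr => b _; rewrite /chi -prodf_div; apply: eq_bigr => i _.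
  by rewrite mulnC [in X in _ / X]mulnC !exprM -expr_div_n.
rewrite -(@bigA_distr_dffun _ _ _ _ _ _ (fun j => Zr (r j))
  (fun j m => z j ^+ (m : 'I_(r j).-1.+1))).
rewrite (bigD1 j) //= [X in X * _](_ : _ = 0) ?mul0r //.
have zj : z j - 1 != 0.
  rewrite subr_eq0; apply: contra neq_j => /eqP z1.
  have := omega_prim _ (r_gt0 j) => prim.
  have : omega R (r j) ^+ coordZ x j == omega R (r j) ^+ coordZ y j.
    apply/eqP; rewrite -[RHS]mul1r -z1 /z divfK //.
    by rewrite expf_neq0 // omega_neq0.
  by rewrite (eq_prim_root_expr prim) !modn_small ?coordZ_lt.
(* Multiplied by [z j - 1], the geometric sum telescopes to [z j ^ r j - 1 = 0]. *)
apply: (mulfI zj); rewrite mulr0 -subrX1 prednK //.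
rewrite /z expr_div_n -!exprM ![(_ * r j)%N]mulnC !exprM omegaX //.
by rewrite !expr1n divr1 subrr.
Qed.

Lemma card_prodZ : #|G|%:R = \prod_j (r j)%:R :> C.
Proof.
rewrite card_dep_ffun foldrE big_image /= natr_prod.
by apply: eq_bigr => j _; rewrite card_ord prednK.
Qed.

Lemma card_prodZ_neq0 : #|G|%:R != 0 :> C.
Proof.
rewrite card_prodZ; apply/prodf_neq0 => j _.
by rewrite pnatr_eq0 -lt0n.
Qed.

(** * Spectral form of the McKay adjacency matrix *)

Let lam (x : G) : C := \sum_j omega R (r j) ^+ coordZ x j.

Lemma chi_eps j (x : G) : chi R (eps r j) x = omega R (r j) ^+ coordZ x j.
Proof.
rewrite /chi (bigD1 j) //= big1 ?mulr1 => [|i ij].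
  (* The coordinate of [eps] is 1 modulo [r j], hence 0 when [r j = 1]; reducing exponents modulo
     [r j] covers this case too. *)
  rewrite {1}/coordZ ffunE eqxx /= exprM (expr_mod 1%N) ?expr1 //.
  by rewrite prednK ?omegaX.
by rewrite {1}/coordZ ffunE (negbTE ij) /= mod0n mul0n expr0.
Qed.

Lemma sum_chi_cexp (c : G) (t : C) :
  #|G|%:R^-1 * \sum_x (chi R c x)^-1 * cexp (lam x * t)
    = \prod_j hyperb (1 + (coordZ c j)%:Z) t (r j).
Proof.
pose F j (m : nat) : C :=
  (omega R (r j) ^+ (coordZ c j * m))^-1 * cexp (omega R (r j) ^+ m * t).
rewrite (eq_bigr (fun x : G => \prod_j F j (x j : 'I_(r j).-1.+1))) => [|x _].
  rewrite -(@bigA_distr_dffun _ _ _ _ _ _ (fun j => Zr (r j))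
    (fun j m => F j (m : 'I_(r j).-1.+1))).
  rewrite card_prodZ -prodfV -big_split; apply: eq_bigr => j _ /=.
  rewrite /hyperb; congr (_ * _); rewrite -(big_mkord xpredT (F j)) prednK //.
  apply: eq_bigr => m _; congr (_ * _).
  (* The shift by 1 in the index of [hyperb] leaves the exponent [- c_j m], which matches the
     inverse of [chi]. *)
  by rewrite opprD addrA subrr add0r mulNr -PoszM -exprnN.
by rewrite big_split /= mulr_suml cexp_sum prodfV.
Qed.

(** The trace is multiplicative on tensor products and additive on direct sums, so the module
    tensored here has character [chi a * lam]; [multiplicity_linear] then applies. *)
Lemma mckayE (a c : G) :
  (mckay R r_gt0 a c)%:R
    = #|G|%:R^-1 * \sum_x lam x * (chi R a x / chi R c x).
Proof.
have trV x : \tr (Vmod R r_gt0 x) = lam x.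
  rewrite (big_morph (fun W : representation C [set: G]%G => \tr (W x))
    (id1 := 0) (op1 := +%R)) /=.
  - by apply: eq_bigr => j _; rewrite mxtrace_scalar mulr1n chi_eps.
  - by move=> W1 W2; rewrite mxtrace_block.
  - by rewrite mxtrace1.
have charG : pgroup [pchar C]^' [set: G]%G.
  apply/pnatP => [|p p_prime _]; first exact: cardG_gt0.
  by rewrite !inE negb_and pnatr_eq0 -lt0n prime_gt0 ?orbT.
have := multiplicity_linear _ _ _ _ (Gmod R r_gt0 c)
  (prod_repr (Gmod R r_gt0 a) (Vmod R r_gt0)) charG.
rewrite cardsT natrM -/(mckay R r_gt0 a c) => mckayG.
apply: (mulIf card_prodZ_neq0); rewrite -mckayG mulrAC.
rewrite mulVf ?card_prodZ_neq0 // mul1r.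
apply: eq_big => [x | x _]; first by rewrite inE.
rewrite mxtrace_prod trV !mxE /= !mulr1n mxtrace_scalar mulr1n chiV.
by rewrite mulrC mulrAC mulrC.
Qed.

Lemma adjacency_mckayX k (a c : G) :
  ((adjacency_mx (mckay R r_gt0) ^+ k) (enum_rank a) (enum_rank c))%:R
    = #|G|%:R^-1 * \sum_x lam x ^+ k * (chi R a x / chi R c x).
Proof.
elim: k a => [|k IH] a.
  (* Symmetry of [chi] moves the summation variable to the argument over which orthogonality
     sums. *)
  under eq_bigr => x _ do rewrite expr0 mul1r chiC [chi R c x]chiC.
  rewrite chi_orthogonality expr0 mxE (inj_eq enum_rank_inj).
  by case: eqP => _; rewrite ?mulr0 // mulVf ?card_prodZ_neq0.
rewrite exprS mxE (reindex enum_rank) /=; last exact/onW_bij/enum_rank_bij.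
rewrite natr_sum.
(* With the intermediate node [b] summed innermost, orthogonality keeps only the terms with
   [y = x]. *)
transitivity (#|G|%:R^-1 * \sum_x \sum_y
    #|G|%:R^-1 * (lam x * chi R a x * lam y ^+ k / chi R c y)
      * \sum_b (chi R b y / chi R b x)).
  under [LHS]eq_bigr => b _.
    rewrite natrM IH mxE !enum_rankK mckayE -mulrA mulr_suml.
    over.
  rewrite -mulr_sumr exchange_big; congr (_ * _); apply: eq_bigr => x _ /=.
  under eq_bigr => b _ do rewrite !mulr_sumr.
  rewrite exchange_big; apply: eq_bigr => y _ /=.
  rewrite mulr_sumr; apply: eq_bigr => b _.
  by field; rewrite card_prodZ_neq0 !chi_neq0.
congr (_ * _); apply: eq_bigr => x _.
rewrite (bigD1 x) //= chi_orthogonality eqxx big1 ?addr0 => [|y yx].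
  by rewrite exprS; field; rewrite card_prodZ_neq0 chi_neq0.
by rewrite chi_orthogonality (negbTE yx) mulr0.
Qed.
(** Each partial sum is a fixed finite linear combination of partial sums of the exponential series
    at [lam x * t], so the limit passes through the sum over [x]. *)
Lemma egf_adjacency_mckay (c : G) (t : C) :
  egf_series (fun k =>
      (adjacency_mx (mckay R r_gt0) ^+ k) (enum_rank 1%g) (enum_rank c)) t @ \oo
    --> \prod_j hyperb (1 + (coordZ c j)%:Z) t (r j).
Proof.
rewrite -sum_chi_cexp.
rewrite (_ : egf_series _ t = fun N => #|G|%:R^-1 * \sum_x
    (chi R c x)^-1 * series (fun k => (lam x * t) ^+ k / k`!%:R) N).
  apply: cvgMr; apply: (cvg_big add_continuous) => x _.
  by apply: cvgMr; exact: series_cvg_cexp.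
apply/funext => N; rewrite /egf_series /series /=.
under eq_bigr => k _ do rewrite adjacency_mckayX -mulrA mulr_suml.
rewrite -mulr_sumr exchange_big; congr (_ * _); apply: eq_bigr => x _ /=.
rewrite mulr_sumr; apply: eq_bigr => k _.
(* The walks start at the zero class [1%g], whose character is constantly 1. *)
by rewrite (chiC 1%g) chi1 exprMn mul1r [lam x ^+ k * _]mulrC !mulrA.
Qed.

End CyclicProduct.

Theorem theorem6p11 (R : realType) (n : nat) (r : 'I_n -> nat)
    (r_gt0 : forall j : 'I_n, (0 < r j)%N) (c : prodZ r) (t : Cplx R) :
  let Q := mckay R r_gt0 in
  let A := adjacency_mx Q in
  let g := \prod_(j < n) hyperb (1 + (coordZ c j)%:Z) t (r j) in
  (egf_series (fun k => #|walks Q k 1%g c|) t @ \oo --> g) /\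
  (egf_series (fun k => (A ^+ k) (enum_rank 1%g) (enum_rank c)) t @ \oo --> g).
Proof.
move=> Q A g; have cvgA := egf_adjacency_mckay _ _ _ r_gt0 c t; split=> //.
rewrite (_ : (fun k => #|walks Q k 1%g c|)
    = fun k => (A ^+ k) (enum_rank 1%g) (enum_rank c)) //.
by apply/funext => k; exact: card_walks.
Qed.
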